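(* Let $A$ be a commutative Noetherian ring with unit and let $n,l$ be natural numbers. Then $A$ has the property $(C_n^l)$ if and only if $\operatorname{cmd}(A_\mathfrak{p})\le l$ for every prime ideal $\mathfrak{p}$ of $A$ such that $\operatorname{depth}(A_\mathfrak{p})\le n-l-1$.
   Context: Natural numbers include $0$; all inequalities are between integers (so $n-l-1$ may be negative). For a Noetherian local ring $R$, the Cohen-Macaulay defect is $\operatorname{cmd}(R)=\dim(R)-\operatorname{depth}(R)$. For natural numbers $n,l$, a Noetherian ring $A$ has the property $(C_n^l)$ if $\operatorname{depth}(A_\mathfrak{p})\ge\min(\operatorname{ht}(\mathfrak{p}),n)-l$ for all $\mathfrak{p}\in\operatorname{Spec}(A)$. *)

(* Defs.v *)
From HB Require Import structures.
From mathcomp Require Import all_boot all_order all_algebra generic_quotient.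
From mathcomp Require Import ring.
From mathcomp Require Import mathcomp_extra boolp classical_sets.
From mathcomp Require Import constructive_ereal.

Set Implicit Arguments.
Unset Strict Implicit.
Unset Printing Implicit Defensive.

Import Order.TTheory GRing.Theory Num.Theory.

Local Open Scope classical_set_scope.
Local Open Scope ring_scope.
Local Open Scope quotient_scope.

(* Commutative rings are [comPzRingType], so the zero ring is allowed.  The   *)
(* ideals of [ring_quotient] are proper by definition and need a nontrivial   *)
(* ring, whence the predicates on [set A] below.                              *)

Definition is_ideal (A : comPzRingType) (I : set A) : Prop :=
  [/\ I 0, forall x y, I x -> I y -> I (x + y) & forall a x, I x -> I (a * x)].

Definition ideal_gen (A : comPzRingType) (G : set A) : set A :=
  smallest (@is_ideal A) G.

Definition noetherian (A : comPzRingType) : Prop :=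
  forall I : set A, is_ideal I -> exists s : seq A, I = ideal_gen [set` s].

Definition is_prime (A : comPzRingType) (P : set A) : Prop :=
  [/\ is_ideal P, ~ P 1 & forall x y, P (x * y) -> P x \/ P y].

Record Spec (A : comPzRingType) := MkSpec {
  prime_set :> set A;
  prime_setP : is_prime prime_set }.

(* The supremum of a set of natural numbers in Z extended with -oo and +oo.   *)
Definition sup_nat (S : set nat) : \bar int :=
  supremum -oo%E [set (k%:Z)%:E | k in S].

Definition prime_chain (A : comPzRingType) (k : nat) (c : nat -> Spec A) :=
  forall i, (i < k)%N -> c i `<` c i.+1.

Definition krull_dim (A : comPzRingType) : \bar int :=
  sup_nat [set k | exists c : nat -> Spec A, prime_chain k c].

Definition height (A : comPzRingType) (p : Spec A) : \bar int :=
  sup_nat [set k | exists c : nat -> Spec A,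
                     prime_chain k c /\ c k = p :> set A].

Definition nonunits (R : comPzRingType) : set R :=
  [set x | ~ exists y, x * y = 1].

Definition is_local (R : comPzRingType) : Prop := is_ideal (@nonunits R).

(* Each [s`_i] is a nonzerodivisor on the quotient of R by the previous ones, *)
(* and the quotient of R by all of them is nonzero.                           *)
Definition regular_seq (R : comPzRingType) (s : seq R) : Prop :=
  (forall i, (i < size s)%N -> forall r : R,
     ideal_gen [set` take i s] (s`_i * r) -> ideal_gen [set` take i s] r)
  /\ ideal_gen [set` s] <> setT.

(* Meant for Noetherian local rings: there [nonunits R] is the maximal ideal, *)
(* and [depth R] and [krull_dim R] are natural numbers.                       *)
Definition depth (R : comPzRingType) : \bar int :=
  sup_nat [set k | exists s : seq R,
    [/\ size s = k, [set` s] `<=` @nonunits R & regular_seq s]].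

Definition cmd (R : comPzRingType) : \bar int := (krull_dim R - depth R)%E.

Section SpecTheory.
Variables (A : comPzRingType) (p : Spec A).

Lemma spec_notin1 : 1 \notin (p : set A).
Proof. by case: p => P [_ n1 _] /=; rewrite notin_setE. Qed.

Lemma spec_notinM x y :
  x \notin (p : set A) -> y \notin (p : set A) -> x * y \notin (p : set A).
Proof.
rewrite !notin_setE; case: p => P [_ _ pr] /= nx ny xy.
by case: (pr _ _ xy).
Qed.

End SpecTheory.

Module Loc.
Section Loc.
Variables (A : comPzRingType) (p : Spec A).

Record fraction := Fraction {
  frac_val :> A * A; _ : frac_val.2 \notin (p : set A) }.

HB.instance Definition _ := [isSub for frac_val].
HB.instance Definition _ := [Choice of fraction by <:].

Lemma denP (x : fraction) : (frac_val x).2 \notin (p : set A).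
Proof. by case: x. Qed.

Definition equivl (x y : fraction) : bool :=
  `[< exists2 u, u \notin (p : set A) & u * (x.1 * y.2 - y.1 * x.2) = 0 >].

Lemma equivl_refl : reflexive equivl.
Proof.
by move=> x; apply/asboolP; exists 1; rewrite ?spec_notin1 // subrr mulr0.
Qed.

Lemma equivl_sym : symmetric equivl.
Proof.
move=> x y; apply/asboolP/asboolP => -[u un e]; exists u => //.
  by rewrite -[RHS]oppr0 -e; ring.
by rewrite -[RHS]oppr0 -e; ring.
Qed.

Lemma equivl_trans : transitive equivl.
Proof.
move=> y x z /asboolP[u un e] /asboolP[v vn f]; apply/asboolP.
exists (u * v * y.2); first by rewrite !spec_notinM ?denP.
transitivity (v * z.2 * (u * (x.1 * y.2 - y.1 * x.2)) +
              u * x.2 * (v * (y.1 * z.2 - z.1 * y.2))); first by ring.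
by rewrite e f !mulr0 addr0.
Qed.

Canonical equivl_equiv := EquivRel equivl equivl_refl equivl_sym equivl_trans.

Definition type := {eq_quot equivl}.
HB.instance Definition _ : EqQuotient _ equivl type := EqQuotient.on type.
HB.instance Definition _ := Choice.on type.

Lemma eqP_pi (x y : fraction) :
  (exists2 u, u \notin (p : set A) & u * (x.1 * y.2 - y.1 * x.2) = 0) <->
  \pi_type x = \pi_type y.
Proof.
split=> [h|/eqmodP/asboolP //].
by apply/eqmodP/asboolP.
Qed.

Lemma repr_pi (x : fraction) : exists2 u, u \notin (p : set A) &
  u * ((repr (\pi_type x)).1 * x.2 - x.1 * (repr (\pi_type x)).2) = 0.
Proof. by apply/eqP_pi; rewrite reprK. Qed.

Definition zerol := @Fraction (0, 1) (spec_notin1 p).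
Definition onel := @Fraction (1, 1) (spec_notin1 p).
Definition addl (x y : fraction) :=
  @Fraction (x.1 * y.2 + y.1 * x.2, x.2 * y.2) (spec_notinM (denP x) (denP y)).
Definition oppl (x : fraction) := @Fraction (- x.1, x.2) (denP x).
Definition mull (x y : fraction) :=
  @Fraction (x.1 * y.1, x.2 * y.2) (spec_notinM (denP x) (denP y)).

Definition zero : type := \pi_type zerol.
Definition one : type := \pi_type onel.
Definition add (a b : type) : type := \pi_type (addl (repr a) (repr b)).
Definition opp (a : type) : type := \pi_type (oppl (repr a)).
Definition mul (a b : type) : type := \pi_type (mull (repr a) (repr b)).

Lemma pi_add x y : add (\pi_type x) (\pi_type y) = \pi_type (addl x y).
Proof.
have [u un e] := repr_pi x; have [v vn f] := repr_pi y.
apply/eqP_pi; exists (u * v); first exact: spec_notinM.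
move: (repr (\pi_type x)) (repr (\pi_type y)) e f => x' y' e f /=.
transitivity (v * y.2 * y'.2 * (u * (x'.1 * x.2 - x.1 * x'.2)) +
              u * x.2 * x'.2 * (v * (y'.1 * y.2 - y.1 * y'.2))); first by ring.
by rewrite e f !mulr0 addr0.
Qed.

Lemma pi_opp x : opp (\pi_type x) = \pi_type (oppl x).
Proof.
have [u un e] := repr_pi x; apply/eqP_pi; exists u => //=.
by rewrite -[RHS]oppr0 -e; ring.
Qed.

Lemma pi_mul x y : mul (\pi_type x) (\pi_type y) = \pi_type (mull x y).
Proof.
have [u un e] := repr_pi x; have [v vn f] := repr_pi y.
apply/eqP_pi; exists (u * v); first exact: spec_notinM.
move: (repr (\pi_type x)) (repr (\pi_type y)) e f => x' y' e f /=.
transitivity (v * y'.1 * y.2 * (u * (x'.1 * x.2 - x.1 * x'.2)) +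
              u * x.1 * x'.2 * (v * (y'.1 * y.2 - y.1 * y'.2))); first by ring.
by rewrite e f !mulr0 addr0.
Qed.

Lemma pi_eq (x y : fraction) :
  x.1 * y.2 - y.1 * x.2 = 0 -> \pi_type x = \pi_type y.
Proof.
by move=> e; apply/eqP_pi; exists 1; rewrite ?spec_notin1 // e mulr0.
Qed.

Lemma addA : associative add.
Proof.
elim/quotW=> x; elim/quotW=> y; elim/quotW=> z.
rewrite (pi_add y) (pi_add x y) (pi_add x) (pi_add _ z).
by apply: pi_eq => /=; ring.
Qed.

Lemma addC : commutative add.
Proof.
elim/quotW=> x; elim/quotW=> y; rewrite (pi_add x) (pi_add y).
by apply: pi_eq => /=; ring.
Qed.

Lemma add0 : left_id zero add.
Proof. by elim/quotW=> x; rewrite pi_add; apply: pi_eq => /=; ring. Qed.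

Lemma addN : left_inverse zero opp add.
Proof. by elim/quotW=> x; rewrite pi_opp pi_add; apply: pi_eq => /=; ring. Qed.

HB.instance Definition _ := GRing.isZmodule.Build type addA addC add0 addN.

Lemma mulA : associative mul.
Proof.
elim/quotW=> x; elim/quotW=> y; elim/quotW=> z.
rewrite (pi_mul y) (pi_mul x y) (pi_mul x) (pi_mul _ z).
by apply: pi_eq => /=; ring.
Qed.

Lemma mulC : commutative mul.
Proof.
elim/quotW=> x; elim/quotW=> y; rewrite (pi_mul x) (pi_mul y).
by apply: pi_eq => /=; ring.
Qed.

Lemma mul1 : left_id one mul.
Proof. by elim/quotW=> x; rewrite pi_mul; apply: pi_eq => /=; ring. Qed.

Lemma mul_addl : left_distributive mul add.
Proof.
elim/quotW=> x; elim/quotW=> y; elim/quotW=> z.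
rewrite (pi_add x y) (pi_mul x) (pi_mul y) (pi_mul _ z).
by rewrite pi_add; apply: pi_eq => /=; ring.
Qed.

Lemma one_neq0 : one != zero.
Proof.
apply/eqP => /eqP_pi[u /=]; rewrite mulr1 mul0r subr0 mulr1 => un u0.
by move: un; rewrite u0 notin_setE; case: p => P [[]].
Qed.

HB.instance Definition _ :=
  GRing.Zmodule_isComNzRing.Build type mulA mulC mul1 mul_addl one_neq0.

End Loc.
End Loc.
HB.export Loc.

Notation localization := Loc.type.

Lemma localization_is_local (A : comPzRingType) (p : Spec A) :
  is_local (localization p).
Proof.
have NU : @nonunits (localization p) =
    [set a | exists2 x : Loc.fraction p, a = \pi_(localization p) x &
                                         x.1 \in (p : set A)].
  have [[p0 pD pM] n1 pr] := prime_setP p.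
  apply/seteqP; split=> [a|_ [x -> xp] [b]] /=.
    elim/quotW: a => x nx; exists x => //.
    apply: contrapT => /negP xp; apply: nx.
    exists (\pi_(localization p) (@Loc.Fraction A p (x.2, x.1) xp)).
    by rewrite [LHS]Loc.pi_mul; apply: Loc.pi_eq => /=; ring.
  elim/quotW: b => y; rewrite [LHS]Loc.pi_mul => /Loc.eqP_pi[u un /=].
  rewrite !mulr1 mul1r mulrBr => /subr0_eq e.
  have := spec_notinM un (spec_notinM (Loc.denP x) (Loc.denP y)).
  rewrite -e notin_setE; apply; apply: (pM).
  by rewrite mulrC; apply: pM; apply/set_mem.
have [[p0 pD pM] _ _] := prime_setP p.
rewrite /is_local NU; split=> [|_ _ [x -> xp] [y -> yp]|b _ [x -> xp]].
- by exists (Loc.zerol p) => //; apply/mem_set.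
- exists (Loc.addl x y); first by rewrite [LHS]Loc.pi_add.
  by apply/mem_set; apply: pD; rewrite mulrC; apply: pM; apply/set_mem.
- elim/quotW: b => y; exists (Loc.mull y x); first by rewrite [LHS]Loc.pi_mul.
  by apply/mem_set; apply: pM; apply/set_mem.
Qed.

Definition property_C (n l : nat) (A : comPzRingType) : Prop :=
  forall p : Spec A,
    (Order.min (height p) (n%:Z)%:E - (l%:Z)%:E <= depth (localization p))%E.

(* Main.v *)
(** Primes of [A_p] correspond to primes of [A] contained in [p]; a chain of
    the former contracts to a chain below [p], whose top can be replaced by
    [p].  Hence [dim A_p = ht p], and what remains is arithmetic with
    [h = ht p] and [d = depth A_p]: if [d >= n - l] the inequality
    [d >= min(h, n) - l] is automatic, and otherwise it says [h - d <= l]. *)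

From HB Require Import structures.
Require Import Defs.
From mathcomp Require Import all_boot all_order all_algebra.
From mathcomp Require Import generic_quotient ring zify.
From mathcomp Require Import boolp classical_sets.
From mathcomp Require Import constructive_ereal.

Local Open Scope ring_scope.

Set Implicit Arguments.
Unset Strict Implicit.
Unset Printing Implicit Defensive.

Import Order.TTheory GRing.Theory Num.Theory.
Local Open Scope classical_set_scope.
Local Open Scope quotient_scope.

Lemma is_prime_preimage (R S : comPzRingType) (f : {rmorphism R -> S})
    (Q : set S) : is_prime Q -> is_prime (f @^-1` Q).
Proof.
move=> [[Q0 QD QM] Q1 Qpr]; split; first split.
- by rewrite /preimage /= rmorph0.
- by move=> x y Qx Qy; rewrite /preimage /= rmorphD; apply: QD.
- by move=> a x Qx; rewrite /preimage /= rmorphM; apply: QM.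
- by rewrite /preimage /= rmorph1.
- by move=> x y; rewrite /preimage /= rmorphM => /Qpr.
Qed.

Lemma prime_chain_subset (A : comPzRingType) (k : nat) (c : nat -> Spec A) :
  prime_chain k c ->
  forall i j, (i <= j)%N -> (j <= k)%N -> (c i : set A) `<=` c j.
Proof.
move=> ch i j; elim: j => [|j IH].
  by rewrite leqn0 => /eqP-> _; exact: subset_refl.
rewrite leq_eqVlt => /predU1P[-> _|ij jk]; first exact: subset_refl.
by apply: subset_trans (IH ij (ltnW jk)) _; have [] := ch j jk.
Qed.

Section Localization.
Variables (A : comPzRingType) (p : Spec A).

Definition to_loc (x : A) : localization p :=
  \pi_(localization p) (@Loc.Fraction A p (x, 1) (spec_notin1 p)).

Lemma to_loc_is_zmod_morphism : zmod_morphism to_loc.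
Proof.
move=> x y; rewrite /to_loc [RHS]/GRing.add /= [X in Loc.add _ X]Loc.pi_opp.
by rewrite Loc.pi_add; apply: Loc.pi_eq => /=; ring.
Qed.

Lemma to_loc_is_monoid_morphism : monoid_morphism to_loc.
Proof.
split=> [|x y]; first exact: Loc.pi_eq (subrr _).
by rewrite [RHS]Loc.pi_mul; apply: Loc.pi_eq => /=; ring.
Qed.

HB.instance Definition _ :=
  GRing.isZmodMorphism.Build A (localization p) to_loc to_loc_is_zmod_morphism.
HB.instance Definition _ :=
  GRing.isMonoidMorphism.Build A (localization p) to_loc
    to_loc_is_monoid_morphism.

Lemma to_loc_num (x : Loc.fraction p) :
  to_loc x.1 = to_loc x.2 * \pi_(localization p) x.
Proof. by rewrite [RHS]Loc.pi_mul; apply: Loc.pi_eq => /=; ring. Qed.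

Lemma to_loc_unit (s : A) :
  s \notin (p : set A) -> exists b : localization p, b * to_loc s = 1.
Proof.
move=> sp; exists (\pi_(localization p) (@Loc.Fraction A p (1, s) sp)).
by rewrite [LHS]Loc.pi_mul; apply: Loc.pi_eq => /=; ring.
Qed.

(** The denominator becomes a unit in the localization, so a fraction and its numerator lie in the
    same ideals. *)
Lemma prime_locE (Q : Spec (localization p)) (x : Loc.fraction p) :
  prime_set Q (\pi_(localization p) x) <-> prime_set Q (to_loc x.1).
Proof.
have [[_ _ QM] _ _] := prime_setP Q; rewrite to_loc_num; split; first exact: QM.
have [b bs] := to_loc_unit (Loc.denP x).
by move=> /(QM b); rewrite mulrA bs mul1r.
Qed.

Definition contraction (Q : Spec (localization p)) : Spec A :=
  MkSpec (is_prime_preimage to_loc (prime_setP Q)).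

(** An element outside [p] becomes invertible, and an invertible element of [Q] would put 1 in
    [Q]. *)
Lemma contraction_sub (Q : Spec (localization p)) :
  (contraction Q : set A) `<=` p.
Proof.
move=> x Qx; apply: contrapT => px.
have [[_ _ QM] Q1 _] := prime_setP Q.
have [|b bx] := @to_loc_unit x; first by rewrite notin_setE.
by apply: Q1; rewrite -bx; apply: QM.
Qed.

(** Membership is decided on numerators. This is what keeps a contracted chain strict. *)
Lemma contraction_subset (Q Q' : Spec (localization p)) :
  (contraction Q : set A) `<=` contraction Q' ->
  (Q : set (localization p)) `<=` Q'.
Proof.
by move=> QQ'; elim/quotW => x /prime_locE Qx; apply/prime_locE/QQ'.
Qed.

(** Only one representative needs its numerator in [q]; for a prime [q] below [p], [extensionE]
    shows that the choice of representative is immaterial. *)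
Definition extension (q : set A) : set (localization p) :=
  [set a | exists2 x : Loc.fraction p,
             a = \pi_(localization p) x & q x.1].

Lemma extensionE (q : Spec A) (x : Loc.fraction p) : (q : set A) `<=` p ->
  extension q (\pi_(localization p) x) <-> prime_set q x.1.
Proof.
move=> qp; split=> [[y /Loc.eqP_pi[u un e] qy]|]; last by exists x.
have [[_ _ qM] _ qpr] := prime_setP q.
(* Clearing denominators puts this product in [q]; as [u * y.2] avoids [p], hence [q], primality
   leaves [x.1]. *)
have {e} : prime_set q ((u * y.2) * x.1).
  suff -> : u * y.2 * x.1 = u * x.2 * y.1 by exact: qM.
  by apply/eqP; rewrite -subr_eq0 -[X in _ == X]e; apply/eqP; ring.
case/qpr => // /qp.
by have := spec_notinM un (Loc.denP y); rewrite notin_setE.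
Qed.

Lemma is_prime_extension (q : Spec A) :
  (q : set A) `<=` p -> is_prime (extension q).
Proof.
move=> qp; have [[q0 qD qM] q1 qpr] := prime_setP q; split; first split.
- by exists (Loc.zerol p).
- move=> _ _ [x -> qx] [y -> qy]; exists (Loc.addl x y).
    by rewrite [LHS]Loc.pi_add.
  by apply: qD; rewrite mulrC; apply: qM.
- elim/quotW=> y _ [x -> qx]; exists (Loc.mull y x).
    by rewrite [LHS]Loc.pi_mul.
  exact: qM.
- by move=> /(extensionE (Loc.onel p) qp).
- elim/quotW=> x; elim/quotW=> y.
  rewrite [X in extension _ X]Loc.pi_mul => /(extensionE _ qp) /qpr.
  by case=> ?; [left|right]; apply/extensionE.
Qed.

(** It suffices to test fractions with denominator 1. This keeps an extended chain strict. *)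
Lemma extension_subset (q q' : Spec A) : (q' : set A) `<=` p ->
  extension q `<=` extension q' -> (q : set A) `<=` q'.
Proof.
move=> q'p qq' x qx; set y := @Loc.Fraction A p (x, 1) (spec_notin1 p).
by apply/(extensionE y q'p)/qq'; exists y.
Qed.

Lemma krull_dim_localization : krull_dim (localization p) = height p.
Proof.
congr sup_nat; apply/seteqP; split=> k.
  (* [height] wants a chain ending exactly at [p], whereas the contraction of [c k] may be
     smaller. *)
  move=> [c ch]; exists (fun i => if (i < k)%N then contraction (c i) else p).
  split; last by rewrite ltnn.
  move=> i ik; rewrite ik; have [cc nc] := ch i ik.
  have cc' : (contraction (c i) : set A) `<=` contraction (c i.+1).
    by move=> x; exact: cc.
  case: ifP => _; split=> //.
  - by move=> /contraction_subset.
  - exact: contraction_sub.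
  (* Last link: if [p] lay in the contraction of [c i], so would the contraction of [c i.+1],
     against strictness. *)
  - move=> pc; apply/nc/contraction_subset.
    exact: subset_trans (@contraction_sub _) pc.
move=> [c [ch ck]].
(* The chain is constrained only up to index [k]; capping the index makes every term a prime below
   [p], so that each can be extended. *)
have cp i : (c (minn i k) : set A) `<=` p.
  by rewrite -ck; exact: prime_chain_subset ch _ _ (geq_minr i k) (leqnn k).
exists (fun i => MkSpec (is_prime_extension (cp i))) => i ik.
have [cc nc] := ch i ik.
have ei : minn i k = i by apply/minn_idPl/ltnW.
have ei1 : minn i.+1 k = i.+1 by apply/minn_idPl.
split=> /=.
  by rewrite ei ei1 => _ [x -> cx]; exists x => //; apply: cc.
by move=> /(extension_subset (cp i)); rewrite ei ei1.
Qed.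

End Localization.

(** Over the integers [d <= n - l - 1] negates [n - l <= d], and the minimum turns the left side
    into [h - l <= d] or [n - l <= d]. Infinite values obey the same equivalence, with the
    convention that [-oo + +oo] is [-oo]. *)
Lemma min_sub_leP (h d : \bar int) (n l : nat) :
  (Order.min h (n%:Z)%:E - (l%:Z)%:E <= d)%E <->
  ((d <= (n%:Z - l%:Z - 1)%:E)%E -> (h - d <= (l%:Z)%:E)%E).
Proof.
case: h => [h| |]; case: d => [d| |]; rewrite ?minye ?minNye -?EFin_min
  -?EFinB ?lee_fin ?leNye ?leey /=; try by split=> // /(_ isT).
- by split; lia.
(* For [h = +oo] and finite [d] the minimum is [n], and the implication says that its premise
   fails. *)
- have -> : (+oo + (- d)%:E <= (l%:Z)%:E)%E = false by [].
  by split; lia.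
Qed.

Theorem proposition3p9 (A : comPzRingType) (n l : nat) (hA : noetherian A) :
  property_C n l A <->
  (forall p : Spec A,
     (depth (localization p) <= (n%:Z - l%:Z - 1)%:E)%E ->
     (cmd (localization p) <= (l%:Z)%:E)%E).
Proof.
by split=> H p; have := H p; rewrite /cmd krull_dim_localization min_sub_leP.
Qed.
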